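(* Let $F:\mathbb{N}^+\times\mathbb{N}^+\to\mathbb{N}^+$ be defined by $$F(m,n)=\frac{1}{4}\left[(m+n-1)^2-\big((m+n-1)\bmod 2\big)\right]+\min(m,n).$$ For every $C\in\mathbb{N}^+$, the equation $F(m,n)=C$ has exactly one solution $(m,n)\in\mathbb{N}^+\times\mathbb{N}^+$ with $m\ge n$. Namely, letting $t=\lfloor\sqrt{C}\rfloor$, $a=\operatorname{sgn}(C-t^2)$ and $b=\operatorname{sgn}'(C-t^2-t)$, this solution is $$m=(1-a)t+a\big[(t+1)(t+1+b)-C\big],\qquad n=(1-a)t+a\big[C-t(t+b)\big].$$
   Context: $\mathbb{N}^+$ denotes the set of positive integers. For an integer $k$, $k\bmod 2$ denotes the least non-negative residue of $k$ modulo $2$. $\operatorname{sgn}$ is the usual signum function, and $\operatorname{sgn}'(x)=\frac{\operatorname{sgn}^2(x)+\operatorname{sgn}(x)}{2}$, i.e. $\operatorname{sgn}'(x)=0$ if $x\le 0$ and $\operatorname{sgn}'(x)=1$ if $x>0$. *)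

(* Defs.v *)
From mathcomp Require Import all_boot all_order all_algebra.
From mathcomp Require Import reals.

Set Implicit Arguments.
Unset Strict Implicit.
Unset Printing Implicit Defensive.

Import Order.TTheory GRing.Theory Num.Theory.
Local Open Scope ring_scope.

(* The positive integers are the [n : nat] with [(0 < n)%N]. *)

(* Real-valued so that the factor 1/4 is a genuine division, with no rounding.
   The truncated [m + n - 1] is the true difference when m and n are positive. *)
Definition F (R : realType) (m n : nat) : R :=
  1 / 4 * ((m + n - 1)%N%:R ^+ 2 - ((m + n - 1) %% 2)%N%:R) + (minn m n)%:R.

Definition sgn' (R : realType) (x : R) : R := (Num.sg x ^+ 2 + Num.sg x) / 2.

Definition floor_sqrt (R : realType) (C : nat) : R :=
  (Num.floor (Num.sqrt (C%:R : R)))%:~R.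

Definition is_solution (R : realType) (C m n : nat) : Prop :=
  [/\ (0 < m)%N, (0 < n)%N, (n <= m)%N & F R m n = C%:R].

(* Main.v *)
(* Write s = m + n - 1.  On the antidiagonal s = 2k the value is k^2 + min(m, n),
   on s = 2k + 1 it is k^2 + k + min(m, n).  For n <= m these antidiagonals fill
   the consecutive blocks [k^2 + 1, k^2 + k] and [k^2 + k + 1, (k + 1)^2], so C
   determines its block through t = floor(sqrt C), and n is the offset of C in it.
   The diagonal points m = n are the ends C = n^2 of the blocks of the second kind,
   where t jumps; this is what the factor a separates. *)
Require Import Defs.
From mathcomp Require Import all_boot all_order all_algebra.
From mathcomp Require Import reals.
From mathcomp Require Import zify ring lra.

Set Implicit Arguments.
Unset Strict Implicit.
Unset Printing Implicit Defensive.

Import Order.TTheory GRing.Theory Num.Theory.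
Local Open Scope ring_scope.

Lemma F_odd_sum (R : realType) (m n k : nat) : (m + n = k.*2.+1)%N ->
  F R m n = (k ^ 2 + minn m n)%:R.
Proof.
move=> mnk; rewrite /F mnk subn1 /= modn2 odd_double -muln2 !natrD natrX natrM /=.
by field.
Qed.

Lemma F_even_sum (R : realType) (m n k : nat) : (m + n = k.*2.+2)%N ->
  F R m n = (k ^ 2 + k + minn m n)%:R.
Proof.
move=> mnk; rewrite /F mnk subn1 /= modn2 /= odd_double -muln2 !natrD natrX.
by rewrite -[(k * 2).+1]addn1 natrD natrM /=; field.
Qed.

(** Recovers the codomain $\mathbb{N}^+$, which the real-valued [F] does not carry in its type. *)
Lemma F_nat (R : realType) (m n : nat) : (0 < m)%N -> (0 < n)%N ->
  exists2 k : nat, (0 < k)%N & F R m n = k%:R.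
Proof.
move=> m0 n0; have [k [mnk|mnk]] : exists k,
    (m + n = k.*2.+1)%N \/ (m + n = k.*2.+2)%N by exists ((m + n).-1./2); lia.
  by exists (k ^ 2 + minn m n)%N; [lia | exact: F_odd_sum].
by exists (k ^ 2 + k + minn m n)%N; [lia | exact: F_even_sum].
Qed.

(** In the last two cases [n <= k] forces k^2 < C < (k + 1)^2, so that [k] is the floor of the
    square root of [C]. *)
Variant solution_spec (C m n : nat) : Prop :=
  | SolutionDiag of (0 < n)%N & m = n & (C = n ^ 2)%N
  | SolutionOdd k of (0 < n <= k)%N & (m + n = k.*2.+1)%N & (C = k ^ 2 + n)%N
  | SolutionEven k of (0 < n <= k)%N & (m + n = k.*2.+2)%N
      & (C = k ^ 2 + k + n)%N.

Lemma is_solutionP (R : realType) (C m n : nat) :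
  is_solution R C m n <-> solution_spec C m n.
Proof.
split=> [[m0 n0 nm]|].
  have [k [mnk|mnk]] : exists k,
      (m + n = k.*2.+1)%N \/ (m + n = k.*2.+2)%N by exists ((m + n).-1./2); lia.
    rewrite (F_odd_sum _ mnk) (minn_idPr nm) => /eqP; rewrite eqr_nat => /eqP CE.
    by apply: (@SolutionOdd _ _ _ k); lia.
  rewrite (F_even_sum _ mnk) (minn_idPr nm) => /eqP; rewrite eqr_nat => /eqP CE.
  (* Here 2n <= m + n = 2k + 2 leaves only n = k + 1 beyond [n <= k]; then m = n and k^2 + k + (k +
     1) = n^2. *)
  have [nk|kn] := leqP n k; first by apply: (@SolutionEven _ _ _ k); lia.
  have nE : n = k.+1 by lia.
  by apply: SolutionDiag; [lia | lia | rewrite -CE nE; lia].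
case=> [n0 -> ->|k nk mnk ->|k nk mnk ->].
- split=> //; rewrite (@F_even_sum _ _ _ n.-1) ?minnn; last lia.
  by congr _%:R; case: n n0 => // n _ /=; lia.
- have nm : (n <= m)%N by lia.
  by split=> //; [lia | lia | rewrite (F_odd_sum _ mnk) (minn_idPr nm)].
- have nm : (n <= m)%N by lia.
  by split=> //; [lia | lia | rewrite (F_even_sum _ mnk) (minn_idPr nm)].
Qed.

Lemma floor_sqrt_eq (R : realType) (C t : nat) :
  (t ^ 2 <= C < t.+1 ^ 2)%N -> floor_sqrt R C = t%:R.
Proof.
move=> /andP[tC Ct]; rewrite /floor_sqrt (@floor_def _ _ t%:Z) ?pmulrn //.
rewrite -[(t%:Z + 1)%R]/((t + 1)%N%:Z) -!pmulrn addn1.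
(* Writing both bounds as square roots reduces the claim to comparing natural numbers. *)
have sqrtX (n : nat) : n%:R = Num.sqrt ((n ^ 2)%N%:R) :> R.
  by rewrite natrX sqrtr_sqr ger0_norm.
rewrite (sqrtX t) (sqrtX t.+1) ler_sqrt ?ler0n // ltr_sqrt ?ltr0n ?expn_gt0 //.
by rewrite ler_nat ltr_nat tC.
Qed.

Lemma sgn'_gt0 (R : realType) (x : R) : 0 < x -> sgn' x = 1.
Proof. by move=> x0; rewrite /sgn' gtr0_sg //; field. Qed.

Lemma sgn'_le0 (R : realType) (x : R) : x <= 0 -> sgn' x = 0.
Proof.
rewrite le_eqVlt /sgn' => /orP[/eqP->|x0]; first by rewrite sgr0; field.
by rewrite ltr0_sg //; field.
Qed.

(** Each case of [solution_spec] fixes [t] and the sign of C - t^2. Off the diagonal, C - t^2 - t is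
    n - k <= 0 in the odd case and n > 0 in the even one, which gives [b]. *)
Lemma solution_formula (R : realType) (C m n : nat) :
  let t : R := floor_sqrt R C in
  let a : R := Num.sg (C%:R - t ^+ 2) in
  let b : R := sgn' (C%:R - t ^+ 2 - t) in
  is_solution R C m n ->
    m%:R = (1 - a) * t + a * ((t + 1) * (t + 1 + b) - C%:R) /\
    n%:R = (1 - a) * t + a * (C%:R - t * (t + b)).
Proof.
move=> t a b /is_solutionP[n0 mE CE|k /andP[n0 nk] mnk CE|k /andP[n0 nk] mnk CE].
- have tE : t = n%:R by apply: floor_sqrt_eq; lia.
  have -> : a = 0 by rewrite /a tE CE natrX subrr sgr0.
  by rewrite tE mE; split; ring.
- have tE : t = k%:R by apply: floor_sqrt_eq; lia.
  have CR : C%:R = k%:R ^+ 2 + n%:R :> R by rewrite CE natrD natrX.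
  have n0R : 0 < n%:R :> R by rewrite ltr0n.
  have nkR : n%:R <= k%:R :> R by rewrite ler_nat.
  have -> : a = 1 by rewrite /a gtr0_sg // tE CR; lra.
  have -> : b = 0 by rewrite /b sgn'_le0 // tE CR; lra.
  have -> : m = (k + k + 1 - n)%N by lia.
  by rewrite natrB ?tE ?CR ?natrD; [split; ring | lia].
- have tE : t = k%:R by apply: floor_sqrt_eq; lia.
  have CR : C%:R = k%:R ^+ 2 + k%:R + n%:R :> R by rewrite CE !natrD natrX.
  have n0R : 0 < n%:R :> R by rewrite ltr0n.
  have k0R : 0 <= k%:R :> R by rewrite ler0n.
  have -> : a = 1 by rewrite /a gtr0_sg // tE CR; lra.
  have -> : b = 1 by rewrite /b sgn'_gt0 // tE CR; lra.
  have -> : m = (k + k + 2 - n)%N by lia.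
  by rewrite natrB ?tE ?CR ?natrD; [split; ring | lia].
Qed.

Lemma solution_exists (C : nat) : (0 < C)%N ->
  exists m n : nat, solution_spec C m n.
Proof.
move=> C0; have [t /andP[tC Ct]] : exists t, (t ^ 2 <= C < t.+1 ^ 2)%N.
  elim: C {C0} => [|C [t /andP[tC Ct]]]; first by exists 0%N.
  have [Ct'|tC'] := ltnP C.+1 (t.+1 ^ 2); first by exists t; lia.
  by exists t.+1; lia.
(* The three cases for the position of [C] in [t^2, (t + 1)^2) match the constructors of
   [solution_spec]; off the diagonal, [m] is the prescribed sum minus the offset [n]. *)
have [CE|Ct2] := eqVneq C (t ^ 2)%N.
  by exists t, t; apply: SolutionDiag => //; case: t CE {tC Ct} => //; lia.
have [Ctt|Ctt] := leqP C (t ^ 2 + t).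
  exists (t.*2.+1 - (C - t ^ 2))%N, (C - t ^ 2)%N.
  by apply: (@SolutionOdd _ _ _ t); lia.
(* The offset is at most [t] because C < (t + 1)^2. *)
exists (t.*2.+2 - (C - t ^ 2 - t))%N, (C - t ^ 2 - t)%N.
by apply: (@SolutionEven _ _ _ t); lia.
Qed.

Theorem theorem5 (R : realType) :
  (forall m n : nat, (0 < m)%N -> (0 < n)%N ->
     exists2 k : nat, (0 < k)%N & F R m n = k%:R) /\
  (forall C : nat, (0 < C)%N ->
     (exists! p : nat * nat, is_solution R C p.1 p.2) /\
     (let t : R := floor_sqrt R C in
      let a : R := Num.sg (C%:R - t ^+ 2) in
      let b : R := sgn' (C%:R - t ^+ 2 - t) in
      forall m n : nat, is_solution R C m n ->
        m%:R = (1 - a) * t + a * ((t + 1) * (t + 1 + b) - C%:R) /\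
        n%:R = (1 - a) * t + a * (C%:R - t * (t + b)))).
Proof.
split=> [|C C0]; first exact: F_nat.
split; last exact: solution_formula.
have [m [n /is_solutionP sol]] := solution_exists C0.
exists (m, n); split; first exact: sol.
(* Uniqueness: the formula depends on [C] alone, and the embedding of the naturals in [R] is
   injective. *)
case=> m' n' /= /solution_formula[m'E n'E].
have [mE nE] := solution_formula (sol R).
by congr pair; apply/eqP; rewrite -(eqr_nat R) ?mE ?nE ?m'E ?n'E.
Qed.
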